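(* The mass of a disk in the hyperbolic plane of uniform density $1$ and hyperbolic radius $r>0$ is $\pi\sinh^2 r$.
   Context: The hyperbolic plane has curvature $-1$, with distance $d$ and area element $dA$. A region is a compact subset of the hyperbolic plane of finite positive measure. A lamina $\mathcal{L}=(L,\lambda)$ consists of a region $L$ and a continuous non-negative function $\lambda$ (the density) on $L$ with $\iint_L\lambda(X)\,dA>0$; it is uniform if $\lambda$ is constant. For a directed straight line (geodesic) $m$, let $\sigma_m(X)=1,-1,0$ according as $X$ is in the left half-plane of $m$, in the right half-plane of $m$, or on $m$. The moment of $\mathcal{L}$ with respect to $m$ is $M_m(\mathcal{L})=\iint_L\sigma_m(X)\lambda(X)\sinh[d(X,m)]\,dA$, and $\mathcal{L}$ is balanced with respect to $m$ if $M_m(\mathcal{L})=0$. The straight lines with respect to which $\mathcal{L}$ is balanced are concurrent, and their common point is the location $C(\mathcal{L})$ of the center of mass of $\mathcal{L}$. The mass of $\mathcal{L}$ is $c(\mathcal{L})=\iint_L\lambda(X)\cosh[d(X,C(\mathcal{L}))]\,dA$. *)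

(* Defs.v *)
From HB Require Import structures.
From mathcomp Require Import all_boot all_order all_algebra ring lra.
From mathcomp Require Import all_classical all_reals all_analysis.
From mathcomp Require Import measurable_realfun.
Set Implicit Arguments.
Unset Strict Implicit.
Unset Printing Implicit Defensive.
Import Order.TTheory GRing.Theory Num.Theory.
Import numFieldNormedType.Exports.
Local Open Scope classical_set_scope.
Local Open Scope ring_scope.

Definition sinh {R : realType} (x : R) : R := (expR x - expR (- x)) / 2.
Definition cosh {R : realType} (x : R) : R := (expR x + expR (- x)) / 2.
Definition arcosh {R : realType} (x : R) : R := ln (x + Num.sqrt (x ^+ 2 - 1)).

(* The hyperbolic plane of curvature -1 is the Poincare upper half-plane, whose
   metric is (dx^2 + dy^2) / y^2; points are pairs of reals with positive
   ordinate, and the topology is the Euclidean one. *)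
Definition hplane {R : realType} : set (R * R) := [set X | 0 < X.2].

Definition hdist {R : realType} (X Y : R * R) : R :=
  arcosh (1 + ((X.1 - Y.1) ^+ 2 + (X.2 - Y.2) ^+ 2) / (2 * X.2 * Y.2)).

(* Integration over A against the area element dx dy / y^2. *)
Definition area_integral {R : realType} (A : set (R * R)) (f : R * R -> R)
    : \bar R :=
  (\int[(@lebesgue_measure R \x @lebesgue_measure R)%E]_(X in A)
     (f X / X.2 ^+ 2)%:E)%E.

Definition harea {R : realType} (A : set (R * R)) : \bar R :=
  area_integral A (fun=> 1).

(* Directed geodesics: the vertical half-line x = c, directed upwards or
   downwards, and the half-circle of centre (c, 0) and radius rho, directed from
   (c - rho, 0) to (c + rho, 0) or backwards. *)
Inductive dline (R : realType) : Type :=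
  | VLine (c : R) (upwards : bool)
  | HCircle (c : R) (rho : {posnum R}) (rightwards : bool).

(* Positive to the left of m, negative to its right, zero on m: the left of an
   upward vertical line is x < c, and the left of a rightward half-circle is its
   exterior. *)
Definition side {R : realType} (m : dline R) (X : R * R) : R :=
  match m with
  | VLine c up => (if up then 1 else -1) * (c - X.1)
  | HCircle c rho rw =>
      (if rw then 1 else -1) * ((X.1 - c) ^+ 2 + X.2 ^+ 2 - rho%:num ^+ 2)
  end.

Definition line_pts {R : realType} (m : dline R) : set (R * R) :=
  [set X | hplane X /\ side m X = 0].

Definition sigma {R : realType} (m : dline R) (X : R * R) : R :=
  Num.sg (side m X).

Definition hdist_line {R : realType} (X : R * R) (m : dline R) : R :=
  inf [set hdist X Y | Y in line_pts m].

Record region (R : realType) := Region {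
  region_set : set (R * R);
  region_sub : region_set `<=` hplane;
  region_compact : compact region_set;
  region_area_gt0 : (0 < harea region_set)%E;
  region_area_lty : (harea region_set < +oo)%E }.

(* Only the values of the density on the region are meaningful. *)
Record lamina (R : realType) := Lamina {
  lregion : region R;
  density : R * R -> R;
  density_continuous : {within region_set lregion, continuous density};
  density_ge0 : forall X, region_set lregion X -> 0 <= density X;
  density_integral_gt0 : (0 < area_integral (region_set lregion) density)%E }.

Definition has_uniform_density {R : realType} (L : lamina R) (c : R) : Prop :=
  forall X, region_set (lregion L) X -> density L X = c.

Definition moment {R : realType} (L : lamina R) (m : dline R) : \bar R :=
  area_integral (region_set (lregion L))
    (fun X => sigma m X * density L X * sinh (hdist_line X m)).

Definition balanced {R : realType} (L : lamina R) (m : dline R) : Prop :=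
  moment L m = 0%E.

Definition common_point {R : realType} (L : lamina R) (C : R * R) : Prop :=
  hplane C /\ forall m, balanced L m -> line_pts m C.

(* The common point of the lines that balance L; (0, 1) is only a default for
   the choice operator, since the common point always exists and is unique. *)
Definition center_of_mass {R : realType} (L : lamina R) : R * R :=
  xget (0, 1) (common_point L).

Definition mass {R : realType} (L : lamina R) : \bar R :=
  area_integral (region_set (lregion L))
    (fun X => density L X * cosh (hdist X (center_of_mass L))).

Definition hdisk {R : realType} (P : R * R) (r : R) : set (R * R) :=
  [set X | hplane X /\ hdist P X <= r].

Lemma arcosh_le {R : realType} (t r : R) : 1 <= t -> 0 <= r ->
  (arcosh t <= r) = (t <= cosh r).
Proof.
move=> t1 r0; rewrite /arcosh /cosh.
have q0 : 0 <= Num.sqrt (t ^+ 2 - 1) by exact: sqrtr_ge0.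
have q2 : Num.sqrt (t ^+ 2 - 1) ^+ 2 = t ^+ 2 - 1 by rewrite sqr_sqrtr; nra.
set q := Num.sqrt _ in q0 q2 *.
rewrite -{1}(expRK r) ler_ln ?posrE ?expR_gt0 //; last by lra.
have e1 : 1 <= expR r by rewrite -expR0 ler_expR.
have : expR r * expR (- r) = 1 by rewrite expRN divff // gt_eqF // expR_gt0.
move: (expR r) (expR (- r)) e1 => e f e1 ef.
have f0 : 0 < f by nra.
apply/idP/idP => [h|h].
  have : t ^+ 2 - 1 <= (e - t) ^+ 2 by rewrite -q2; nra.
  move=> h2; have : 2 * t * e <= (e + f) * e by nra.
  by rewrite ler_pM2r; lra.
have fe : f <= e by nra.
have : q ^+ 2 <= ((e - f) / 2) ^+ 2 by rewrite q2; nra.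
rewrite ler_sqr ?nnegrE //; lra.
Qed.

Lemma hdiskE {R : realType} (P : R * R) (r : R) : hplane P -> 0 < r ->
  hdisk P r = [set X | (X.1 - P.1) ^+ 2 + (X.2 - P.2 * cosh r) ^+ 2
                       <= (P.2 * sinh r) ^+ 2].
Proof.
rewrite /hplane /= => P0 r0.
have r0' := ltW r0.
have ef : expR r * expR (- r) = 1 by rewrite expRN divff // gt_eqF // expR_gt0.
have e1 : 1 < expR r by rewrite -expR0 ltr_expR.
apply/seteqP; split => -[x y] /=; rewrite /hplane /hdist /=; case: P P0 => a b /= b0.
  case=> /= y0. rewrite /hplane /= in y0.
  rewrite /= arcosh_le//; last first.
    by rewrite lerDl divr_ge0 // ?addr_ge0 ?sqr_ge0 // !mulr_ge0 //= ?ltW.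
  rewrite -lerBrDl ler_pdivrMr; last by rewrite !mulr_gt0.
  rewrite /cosh /sinh; move: ef; move: (expR r) (expR (-r)) => e f ef.
  have -> : (b * ((e - f) / 2)) ^+ 2 = b ^+ 2 * (((e + f) / 2) ^+ 2 - 1).
    by transitivity (b ^+ 2 * (((e + f) / 2) ^+ 2 - e * f)); [field|rewrite ef].
  by rewrite /=; nra.
move=> h.
have y0 : 0 < y.
  move: h; rewrite /cosh /sinh; move: ef e1; move: (expR r) (expR (-r)) => e f ef e1.
  have f0 : 0 < f by nra.
  have fe : f < e by nra.
  move=> h; rewrite ltNge; apply/negP => yn.
  have : (b * (e + f) / 2) ^+ 2 <= (b * ((e - f) / 2)) ^+ 2.
    apply: le_trans h; have : 0 < b * (e+f) by rewrite mulr_gt0 //; lra.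
    have -> : b * ((e+f)/2) = b * (e+f) / 2 by ring.
    move: (b * (e + f)) => z z0.
    have := sqr_ge0 (x - a); have := sqr_ge0 y; have : 0 <= - y * z by rewrite mulr_ge0; lra. lra.
  rewrite ler_sqr ?nnegrE; nra.
split=> //; rewrite /hdist /=.
rewrite arcosh_le//; last first.
  by rewrite lerDl divr_ge0 // ?addr_ge0 ?sqr_ge0 // !mulr_ge0 //= ?ltW.
rewrite -lerBrDl ler_pdivrMr; last by rewrite !mulr_gt0.
move: h; rewrite /cosh /sinh; move: ef; move: (expR r) (expR (-r)) => e f ef.
have -> : (b * ((e - f) / 2)) ^+ 2 = b ^+ 2 * (((e + f) / 2) ^+ 2 - 1).
  by transitivity (b ^+ 2 * (((e + f) / 2) ^+ 2 - e * f)); [field|rewrite ef].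
by rewrite /=; nra.
Qed.

Lemma hdisk_box {R : realType} (P : R * R) (r : R) : hplane P -> 0 < r ->
  exists a b k u v : R, [/\ 0 < k, 0 < u, k <= b - u, 0 < v &
   `[a - v, a + v] `*` `[b - v, b + v] `<=` hdisk P r /\
   hdisk P r `<=` `[a - u, a + u] `*` `[b - u, b + u]].
Proof.
move=> HP r0; rewrite hdiskE//; move: HP; case: P => a b /= b0.
have ef : expR r * expR (- r) = 1 by rewrite expRN divff // gt_eqF // expR_gt0.
have e1 : 1 < expR r by rewrite -expR0 ltr_expR.
exists a, (b * cosh r), (b * expR (- r)), (b * sinh r), (b * sinh r / 2).
have s0 : 0 < b * sinh r.
  rewrite /hplane /= in b0; rewrite mulr_gt0 // /sinh; nra.
rewrite /hplane /= in b0.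
split=> //.
- by rewrite mulr_gt0 // expR_gt0.
- by rewrite /cosh /sinh; lra.
- by rewrite divr_gt0.
move: (b * sinh r) (b * cosh r) s0 => s c s0; split => -[x y] /=.
  by rewrite !in_itv /= => -[/andP[? ?] /andP[? ?]]; nra.
move=> h; rewrite !in_itv /=.
have hx : (x - a) ^+ 2 <= s ^+ 2 by have := sqr_ge0 (y - c); lra.
have hy : (y - c) ^+ 2 <= s ^+ 2 by have := sqr_ge0 (x - a); lra.
have t z : z ^+ 2 <= s ^+ 2 -> - s <= z <= s.
  by move=> hz; rewrite -ler_norml -ler_sqr ?nnegrE ?(ltW s0) // real_normK ?num_real.
by have /andP[? ?] := t _ hx; have /andP[? ?] := t _ hy; split; lra.
Qed.

Lemma hdisk_compact {R : realType} (P : R * R) (r : R) :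
  hplane P -> 0 < r -> compact (hdisk P r).
Proof.
move=> HP r0; have [a [b [k [u [v [_ _ _ _ [_ hu]]]]]]] := hdisk_box HP r0.
apply: subclosed_compact hu; last first.
  by apply: compact_setX; exact: segment_compact.
rewrite hdiskE//.
pose f (X : R * R) := (X.1 - P.1) ^+ 2 + (X.2 - P.2 * cosh r) ^+ 2.
rewrite (_ : [set _ | _] = f @^-1` [set y | y <= (P.2 * sinh r) ^+ 2]) //.
apply: closed_comp; last exact: closed_le.
move=> X _; rewrite /f.
have c1 : {for X, continuous (fun X : R * R => X.1 - P.1)}.
  by apply: cvgB; [exact: cvg_fst|exact: cvg_cst].
have c2 : {for X, continuous (fun X : R * R => X.2 - P.2 * cosh r)}.
  by apply: cvgB; [exact: cvg_snd|exact: cvg_cst].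
by apply: cvgD; under eq_fun do rewrite expr2; apply: cvgM.
Qed.

Lemma hdisk_measurable {R : realType} (P : R * R) (r : R) : hplane P -> 0 < r ->
  measurable (hdisk P r : set (measurableTypeR R * measurableTypeR R)).
Proof.
move=> HP r0; rewrite hdiskE//.
pose f (X : measurableTypeR R * measurableTypeR R) :=
  (X.1 - P.1) ^+ 2 + (X.2 - P.2 * cosh r) ^+ 2.
rewrite (_ : [set _ | _] = setT `&` f @^-1` `]-oo, (P.2 * sinh r) ^+ 2]); last first.
  by rewrite setTI; apply/seteqP; split => X /=; rewrite in_itv.
suff : measurable_fun setT f by apply => //; exact: measurable_itv.
apply: measurable_funD; apply: measurable_funX; apply: measurable_funB => //.
Qed.

Lemma hdisk_area {R : realType} (P : R * R) (r : R) : hplane P -> 0 < r ->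
  (0 < harea (hdisk P r) < +oo)%E.
Proof.
move=> HP r0; have [a [b [k [u [v [k0 u0 kbu v0 [hv hu]]]]]]] := hdisk_box HP r0.
rewrite /harea /area_integral.
set mu := (_ \x _)%E.
pose B t : set (measurableTypeR R * measurableTypeR R) :=
  `[a - t, a + t] `*` `[b - t, b + t].
have hB t X : B t X -> b - t <= X.2 <= b + t.
  by rewrite /B /= !in_itv /= => -[].
have mD := hdisk_measurable HP r0.
have mB t : measurable (B t).
  by apply: measurableX; exact: measurable_itv.
have muB t : 0 < t ->
    mu (B t) = ((2 * t) ^+ 2)%:E.
  move=> t0; rewrite /mu product_measure1E; [|exact: measurable_itv..].
  have lm c : lebesgue_measure (`[c - t, c + t]%classic : set R) = (2 * t)%:E.
    rewrite lebesgue_measure_itv /= lte_fin ifT; last by lra.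
    by rewrite -EFinB; congr EFin; ring.
  by rewrite expr2 EFinM; congr (_ * _)%E; exact: lm.
have mp : measurable_fun [set: measurableTypeR R]
    ((@powR R ^~ (- 2)) : measurableTypeR R -> R) by exact: measurable_powR.
have mf (A : set (measurableTypeR R * measurableTypeR R)) : measurable A -> A `<=` B u ->
    measurable_fun A (fun X : measurableTypeR R * measurableTypeR R =>
      (1 / X.2 ^+ 2)%:E).
  move=> mA sA; apply/measurable_EFinP.
  apply: (eq_measurable_fun (fun X => (X.2 `^ (- 2)))).
    move=> [x y] /[!inE] /sA/hB/andP[/= hy _].
    by rewrite powRN div1r -[2]/(2%:R) powR_mulrn//; lra.
  apply: measurable_funTS.
  exact: (measurableT_comp mp measurable_snd).
apply/andP; split.
  apply: (@lt_le_trans _ _ (\int[mu]_(X in B v)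
    (1 / (b + u)%R ^+ 2)%:E)%E).
    rewrite integral_cst; last exact: mB.
    rewrite [X in (_ * X)%E](muB _ v0) -EFinM lte_fin.
    by rewrite mulr_gt0 ?divr_gt0 ?exprn_gt0 //; lra.
  apply: (@le_trans _ _ (\int[mu]_(X in B v)
    (1 / X.2 ^+ 2)%:E)%E).
    apply: ge0_le_integral => //.
    - by move=> X _; rewrite lee_fin divr_ge0 // sqr_ge0.
    - by apply: mf => // X /hv /hu.
    - move=> [x y] /hv /hu /hB /andP[/= h1 h2].
      rewrite lee_fin !div1r lef_pV2 ?posrE ?exprn_gt0//; try lra.
      by rewrite ler_sqr ?nnegrE; lra.
  apply: ge0_subset_integral => //; first exact: mf.
  by move=> X _; rewrite lee_fin divr_ge0 // sqr_ge0.
apply: (@le_lt_trans _ _ (\int[mu]_(X in hdisk P r) (1 / k ^+ 2)%:E)%E).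
  apply: ge0_le_integral => //.
  - by move=> X _; rewrite lee_fin divr_ge0 // sqr_ge0.
  - by apply: mf.
  - move=> [x y] /hu /hB /andP[/= h1 h2].
    rewrite lee_fin !div1r lef_pV2 ?posrE ?exprn_gt0//; try lra.
    by rewrite ler_sqr ?nnegrE; lra.
rewrite integral_cst//.
apply: (@le_lt_trans _ _ ((1 / k ^+ 2)%:E * ((2 * u) ^+ 2)%:E)%E); last first.
  by rewrite -EFinM ltry.
rewrite lee_wpmul2l ?lee_fin ?divr_ge0 ?sqr_ge0// -(muB _ u0).
by apply: le_measure; rewrite ?inE.
Qed.

(* The closed disk is a region and carries the uniform density 1. *)
Lemma uniform_disk_lamina {R : realType} (P : R * R) (r : R) :
  hplane P -> 0 < r ->
  exists2 L : lamina R,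
    region_set (lregion L) = hdisk P r & has_uniform_density L 1.
Proof.
move=> HP r0; have /andP[a0 aoo] := hdisk_area HP r0.
pose D := @Region R (hdisk P r) (fun X => @proj1 _ _) (hdisk_compact HP r0) a0 aoo.
have cD : {within region_set D, continuous (fun=> 1 : R)}.
  by apply: continuous_subspaceT => X; exact: cvg_cst.
by exists (@Lamina R D (fun=> 1) cD (fun _ _ => ler01) a0).
Qed.

(* Main.v *)
(* In the coordinates (x, y), the signed quantity sigma_m sinh d(., m), for any
   line m, and cosh d(., P) are linear combinations of 1/y, x/y and
   (x^2 + y^2)/y, that is, linear forms on the hyperboloid model. For the disk of
   centre P = (a, b), the functions (x - a)/y and ((x - a)^2 + y^2 - b^2)/y
   integrate to zero, and 1/y integrates to pi sinh^2 r / b. Hence the moment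
   with respect to m is a positive multiple of the side of P with respect to m:
   the balancing lines are exactly the lines through P, so P is the center of
   mass. Finally cosh d(., P) is b/y plus a multiple of a function of integral
   zero. *)
Require Import Defs.
From mathcomp Require Import all_boot all_order all_algebra ring lra.
From mathcomp Require Import all_classical all_reals all_analysis.
From mathcomp Require Import measurable_realfun.
Import Order.TTheory GRing.Theory Num.Theory.
Import numFieldNormedType.Exports.
Local Open Scope classical_set_scope.
Local Open Scope ring_scope.

(** * Hyperbolic functions and [arcosh] *)

Lemma sinh_gt0 {R : realType} (x : R) : 0 < x -> 0 < sinh x.
Proof.
by move=> x0; rewrite /sinh divr_gt0 // subr_gt0 ltr_expR; lra.
Qed.

Lemma cosh_sqr {R : realType} (x : R) : cosh x ^+ 2 = 1 + sinh x ^+ 2.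
Proof.
have ef : expR x * expR (- x) = 1 by rewrite expRN divff // gt_eqF // expR_gt0.
rewrite /cosh /sinh; move: ef; move: (expR x) (expR (- x)) => e f ef.
by transitivity (e * f + ((e - f) / 2) ^+ 2); [field | rewrite ef].
Qed.

Lemma cosh_gt0 {R : realType} (x : R) : 0 < cosh x.
Proof. by rewrite /cosh divr_gt0 // addr_gt0 // expR_gt0. Qed.

Lemma expR_arcosh {R : realType} (t : R) : 1 <= t ->
  expR (arcosh t) = t + Num.sqrt (t ^+ 2 - 1).
Proof.
move=> t1; rewrite lnK // posrE.
by have := sqrtr_ge0 (t ^+ 2 - 1); lra.
Qed.

(** With [q] the square root, [t + q] and [t - q] are inverse to each other, since
    [t ^+ 2 - q ^+ 2 = 1]. *)
Lemma expRN_arcosh {R : realType} (t : R) : 1 <= t ->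
  expR (- arcosh t) = t - Num.sqrt (t ^+ 2 - 1).
Proof.
move=> t1; rewrite expRN expR_arcosh //.
have q2 : Num.sqrt (t ^+ 2 - 1) ^+ 2 = t ^+ 2 - 1 by rewrite sqr_sqrtr; nra.
have tq : t + Num.sqrt (t ^+ 2 - 1) != 0.
  by rewrite gt_eqF //; have := sqrtr_ge0 (t ^+ 2 - 1); lra.
by apply: (mulfI tq); rewrite divff // mulrC -subr_sqr q2; ring.
Qed.

Lemma cosh_arcosh {R : realType} (t : R) : 1 <= t -> cosh (arcosh t) = t.
Proof.
by move=> t1; rewrite /cosh expR_arcosh // expRN_arcosh //; field.
Qed.

Lemma sinh_arcosh {R : realType} (t : R) :
  1 <= t -> sinh (arcosh t) = Num.sqrt (t ^+ 2 - 1).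
Proof.
by move=> t1; rewrite /sinh expR_arcosh // expRN_arcosh //; field.
Qed.

Lemma arcosh_ge0 {R : realType} (t : R) : 1 <= t -> 0 <= arcosh t.
Proof.
move=> t1; rewrite /arcosh ln_ge0 //.
by have := sqrtr_ge0 (t ^+ 2 - 1); lra.
Qed.

Lemma ler_arcosh {R : realType} (t u : R) :
  1 <= t -> t <= u -> arcosh t <= arcosh u.
Proof.
move=> t1 tu; rewrite arcosh_le //; last by rewrite arcosh_ge0 //; lra.
by rewrite cosh_arcosh //; lra.
Qed.

(** * Distance from a point to a geodesic *)

Lemma cosh_hdist {R : realType} (X Y : R * R) : hplane X -> hplane Y ->
  cosh (hdist X Y) = ((X.1 - Y.1) ^+ 2 + X.2 ^+ 2 + Y.2 ^+ 2) / (2 * X.2 * Y.2).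
Proof.
rewrite /hplane /= => X0 Y0; rewrite cosh_arcosh.
  by field; lra.
by rewrite lerDl divr_ge0 ?addr_ge0 ?sqr_ge0 ?mulr_ge0 // ltW.
Qed.

(** Reduces the infimum to exhibiting a foot [Y]: [arcosh] is increasing, so minimizing [cosh] of
    the distance makes the infimum a minimum, and [k >= 0] fixes the sign of the root of
    [cosh ^+ 2 - 1]. *)
Lemma sinh_hdist_line {R : realType} (m : dline R) (X Y : R * R) (k : R) :
  hplane X -> line_pts m Y -> 0 <= k ->
  (forall Z, line_pts m Z -> cosh (hdist X Y) <= cosh (hdist X Z)) ->
  cosh (hdist X Y) ^+ 2 = 1 + k ^+ 2 -> sinh (hdist_line X m) = k.
Proof.
move=> X0 mY k0 Ymin Yk.
have t1 Z : line_pts m Z ->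
    1 <= 1 + ((X.1 - Z.1) ^+ 2 + (X.2 - Z.2) ^+ 2) / (2 * X.2 * Z.2).
  rewrite /line_pts /hplane /= in X0 *; move=> [Z0 _].
  by rewrite lerDl divr_ge0 ?addr_ge0 ?sqr_ge0 ?mulr_ge0 // ltW.
have -> : hdist_line X m = hdist X Y.
  apply/eqP; rewrite eq_le; apply/andP; split.
    apply: ge_inf; last by exists Y.
    by exists 0 => _ [Z mZ <-]; apply: arcosh_ge0; exact: t1.
  apply: lb_le_inf; first by exists (hdist X Y), Y.
  move=> _ [Z mZ <-]; apply: ler_arcosh; first exact: t1.
  by have := Ymin _ mZ; rewrite /hdist !cosh_arcosh //; exact: t1.
move: Yk; rewrite /hdist cosh_arcosh ?sinh_arcosh; try exact: t1.
by move=> ->; rewrite addrAC subrr add0r sqrtr_sqr ger0_norm.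
Qed.

Lemma sinh_hdist_VLine {R : realType} (c : R) (up : bool) (X : R * R) :
  hplane X -> sinh (hdist_line X (VLine c up)) = `|X.1 - c| / X.2.
Proof.
move=> X0; have x0 := X0; rewrite /hplane /= in x0.
(* The perpendicular from [X] is the half-circle about [(c, 0)] through [X]; it meets the line at
   height [v]. *)
pose v := Num.sqrt ((X.1 - c) ^+ 2 + X.2 ^+ 2).
have s0 : 0 < (X.1 - c) ^+ 2 + X.2 ^+ 2 by rewrite ltr_wpDl ?sqr_ge0 ?exprn_gt0.
have v0 : 0 < v by rewrite sqrtr_gt0.
have v2 : v ^+ 2 = (X.1 - c) ^+ 2 + X.2 ^+ 2 by rewrite sqr_sqrtr // ltW.
have Yk : cosh (hdist X (c, v)) = v / X.2.
  by rewrite cosh_hdist //= -v2; field; lra.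
apply: (@sinh_hdist_line _ _ _ (c, v)) => //.
- by split => //=; rewrite subrr mulr0.
- by rewrite divr_ge0 // ltW.
- move=> [p q] [/= q0] h; rewrite /hplane /= in q0.
  have -> : p = c by move: h; case: up => /=; lra.
  rewrite Yk cosh_hdist //= ler_pdivlMr ?mulr_gt0 // -v2.
  have -> : v / X.2 * (2 * X.2 * q) = 2 * v * q by field; lra.
  by have := sqr_ge0 (v - q); lra.
- rewrite Yk !expr_div_n real_normK ?num_real // v2.
  by field; lra.
Qed.

Lemma sinh_hdist_HCircle {R : realType} (c : R) (rho : {posnum R}) (rw : bool)
    (X : R * R) : hplane X ->
  sinh (hdist_line X (HCircle c rho rw)) =
  `|(X.1 - c) ^+ 2 + X.2 ^+ 2 - rho%:num ^+ 2| / (2 * rho%:num * X.2).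
Proof.
move=> X0; have x0 := X0; rewrite /hplane /= in x0.
have r0 : 0 < rho%:num by [].
case: X X0 x0 => x y X0 /= y0.
pose p := x - c; pose N := p ^+ 2 + y ^+ 2 + rho%:num ^+ 2.
have N0 : 0 < N by rewrite /N; have := sqr_ge0 p; nra.
(* This form shows that the radicand of [E] is positive, and later identifies [cosh ^+ 2 - 1] with
   the square of the claimed value. *)
have E0 : N ^+ 2 - 4 * rho%:num ^+ 2 * p ^+ 2 =
    (p ^+ 2 + y ^+ 2 - rho%:num ^+ 2) ^+ 2 + 4 * rho%:num ^+ 2 * y ^+ 2.
  by rewrite /N; ring.
pose E := Num.sqrt (N ^+ 2 - 4 * rho%:num ^+ 2 * p ^+ 2).
have Epos : 0 < N ^+ 2 - 4 * rho%:num ^+ 2 * p ^+ 2.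
  by rewrite E0 ltr_wpDl ?sqr_ge0 // !mulr_gt0 ?exprn_gt0.
have Egt0 : 0 < E by rewrite sqrtr_gt0.
have E2 : E ^+ 2 = N ^+ 2 - 4 * rho%:num ^+ 2 * p ^+ 2.
  by rewrite sqr_sqrtr // ltW.
(* The foot, relative to the centre [c]: [(u, v)] is the vector of norm [rho] parallel to
   [(2 * rho * p, E)], the equality case of the Cauchy-Schwarz bound below. *)
pose u := 2 * rho%:num ^+ 2 * p / N; pose v := rho%:num * E / N.
have v0 : 0 < v by rewrite divr_gt0 // mulr_gt0.
have uv : u ^+ 2 + v ^+ 2 = rho%:num ^+ 2.
  rewrite /u /v !expr_div_n !exprMn E2; field; lra.
have Yk : cosh (hdist (x, y) (c + u, v)) = E / (2 * rho%:num * y).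
  rewrite cosh_hdist //=.
  have -> : (x - (c + u)) ^+ 2 + y ^+ 2 + v ^+ 2 = N - 2 * p * u.
    by rewrite /N -uv /p; ring.
  have -> : N - 2 * p * u = E ^+ 2 / N.
    by rewrite E2 /u; field; lra.
  by rewrite /v; field; rewrite !gt_eqF.
apply: (@sinh_hdist_line _ _ _ (c + u, v)) => //.
- split => //=.
  by rewrite (_ : c + u - c = u) ?uv ?subrr ?mulr0 //; ring.
- by rewrite divr_ge0 ?mulr_ge0 // ltW.
- move=> [z w] [/= w0] h; rewrite /hplane /= in w0.
  pose t := z - c.
  have tw : t ^+ 2 + w ^+ 2 = rho%:num ^+ 2.
    by move: h; rewrite -/t; case: rw; lra.
  rewrite Yk cosh_hdist //=.
  have -> : (x - z) ^+ 2 + y ^+ 2 + w ^+ 2 = N - 2 * p * t.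
    by rewrite /N -tw /p /t; ring.
  rewrite ler_pdivlMr ?mulr_gt0 //.
  have -> : E / (2 * rho%:num * y) * (2 * y * w) = E * w / rho%:num.
    by field; rewrite !gt_eqF.
  rewrite ler_pdivrMr //.
  (* Cauchy-Schwarz for (2 rho p, E), of norm N, and (t, w), of norm rho *)
  have cs : (2 * rho%:num * p * t + E * w) ^+ 2 <= (N * rho%:num) ^+ 2.
    have := sqr_ge0 (2 * rho%:num * p * w - E * t).
    have -> : (N * rho%:num) ^+ 2 =
        (E ^+ 2 + 4 * rho%:num ^+ 2 * p ^+ 2) * (t ^+ 2 + w ^+ 2).
      by rewrite E2 tw; ring.
    by lra.
  have Nr : 0 <= N * rho%:num by rewrite mulr_ge0 // ltW.
  have := ler_norm (2 * rho%:num * p * t + E * w).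
  have : `|2 * rho%:num * p * t + E * w| <= N * rho%:num.
    by rewrite -ler_sqr ?nnegrE // real_normK ?num_real.
  lra.
- rewrite Yk !expr_div_n real_normK ?num_real // E2 E0 /p /=.
  by field; rewrite !gt_eqF.
Qed.

(** * One-dimensional integrals over the slices *)

(** The derivative is asked for only on the open interval: the primitive used for the disk contains
    a square root that vanishes at both ends. *)
Lemma integral_is_derive {R : realType} (f F : R -> R) (a b : R) : a < b ->
  (forall x, a <= x <= b -> {for x, continuous f}) ->
  (forall x, a <= x <= b -> {for x, continuous F}) ->
  (forall x, a < x < b -> is_derive x 1 F (f x)) ->
  (\int[lebesgue_measure]_(x in `[a, b]) (f x)%:E)%E = (F b - F a)%:E.
Proof.
move=> ab cf cF dF; rewrite (@continuous_FTC2 _ f F) ?EFinB //.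
- apply: continuous_in_subspaceT => x; rewrite inE /= in_itv /=; exact: cf.
- split.
  + by move=> x; rewrite in_itv /= => /dF dFx; exact: ex_derive.
  + by apply: cvg_at_right_filter; apply: cF; rewrite lexx ltW.
  + by apply: cvg_at_left_filter; apply: cF; rewrite lexx ltW.
- move=> x; rewrite in_itv /= => /dF dFx.
  by rewrite derive1E derive_val.
Qed.

Lemma integral_quadratic {R : realType} (A B C a s : R) : 0 <= s ->
  (\int[lebesgue_measure]_(x in `[(a - s)%R, (a + s)%R])
     (A + B * (x - a) + C * (x - a) ^+ 2)%:E)%E
  = (2 * s * A + 2 / 3 * s ^+ 3 * C)%:E.
Proof.
(* The degenerate case [s = 0] occurs for the top and bottom slices of a disk. *)
rewrite le_eqVlt => /orP[/eqP <-|s0].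
  by rewrite subr0 addr0 set_itv1 integral_set1; congr EFin; ring.
pose F (x : R) := A * (x - a) + B / 2 * (x - a) ^+ 2 + C / 3 * (x - a) ^+ 3.
have dF (x : R) : is_derive x 1 F (A + B * (x - a) + C * (x - a) ^+ 2).
  by apply: is_derive_eq; rewrite /GRing.scale /=; field.
have -> : 2 * s * A + 2 / 3 * s ^+ 3 * C = F (a + s) - F (a - s).
  by rewrite /F; field.
apply: integral_is_derive.
- by lra.
- move=> x _; apply: continuousD; first apply: continuousD.
  + exact: cvg_cst.
  + apply: continuousM; first exact: cvg_cst.
    by apply: continuousB; [exact: cvg_id|exact: cvg_cst].
  + apply: continuousM; first exact: cvg_cst.
    apply: (@continuous_comp _ _ _ (fun x => x - a) (fun x => x ^+ 2));
      last exact: exprn_continuous.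
    by apply: continuousB; [exact: cvg_id|exact: cvg_cst].
- by move=> x _; apply: differentiable_continuous; apply/derivable1_diffP.
Qed.

(* The area under the graph of [sqrt (c^2 - v^2)], in parametric form; the
   half-angle [atan (v / (c + w))] is [asin (v / c) / 2], but stays smooth up to
   [v = c] and [v = - c]. *)
Lemma is_derive_circle_segment {R : realType} (v w : R -> R) (c x V W : R) :
  0 < c -> 0 < w x -> v x ^+ 2 + w x ^+ 2 = c ^+ 2 ->
  v x * V + w x * W = 0 ->
  is_derive x 1 v V -> is_derive x 1 w W ->
  is_derive x 1
    (fun y => v y * w y + 2 * c ^+ 2 * atan (v y / (c + w y))) (2 * w x * V).
Proof.
move=> c0 w0 vw VW dv dw.
have cw : c + w x != 0 by rewrite gt_eqF // addr_gt0.
have dcw : is_derive x 1 (fun y => c + w y) W.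
  by rewrite -[W]add0r; exact: (is_deriveD (is_derive_cst c x 1) dw).
have di : is_derive x 1 (fun y => (c + w y)^-1) (- (c + w x) ^- 2 *: W).
  exact: is_deriveV.
have dq : is_derive x 1 (fun y => v y / (c + w y))
    ((V * (c + w x) - v x * W) / (c + w x) ^+ 2).
  by apply: is_derive_eq; rewrite /GRing.scale /=; field.
have dt : is_derive x 1 (fun y => atan (v y / (c + w y)))
    (V / (2 * w x)).
  apply: (is_derive_eq (is_derive1_comp (is_derive1_atan _) dq)).
  (* Differentiating the circle equation determines [W] from [V]; the equation itself then
     simplifies [1 + (v / (c + w)) ^+ 2] to [2 * c / (c + w)]. *)
  have -> : W = - (v x * V) / w x.
    have w0' : w x != 0 by rewrite gt_eqF.
    by apply: (mulfI w0'); rewrite mulrCA divff // mulr1; lra.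
  have -> : 1 + (v x / (c + w x)) ^+ 2 = (2 * c) / (c + w x).
    have -> : 1 + (v x / (c + w x)) ^+ 2 =
        (c ^+ 2 + 2 * c * w x + (v x ^+ 2 + w x ^+ 2)) / (c + w x) ^+ 2.
      by field.
    by rewrite vw; field.
  have -> : V * (c + w x) - v x * (- (v x * V) / w x) =
      V * (c * w x + (v x ^+ 2 + w x ^+ 2)) / w x.
    by field; rewrite gt_eqF.
  by rewrite vw; field; rewrite !gt_eqF ?addr_gt0.
apply: is_derive_eq; rewrite /GRing.scale /=.
have -> : W = - (v x * V) / w x.
  have w0' : w x != 0 by rewrite gt_eqF.
  by apply: (mulfI w0'); rewrite mulrCA divff // mulr1; lra.
transitivity (V * (w x ^+ 2 - v x ^+ 2 + c ^+ 2) / w x).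
  by field; rewrite !gt_eqF.
by rewrite -vw; field; rewrite gt_eqF.
Qed.

(* In the variable [v = b / y - h / b], the slice length [2 * s y] over [y] is
   [2 * sqrt (c ^ 2 - v ^ 2)], and [dv = - b / y ^ 2 dy]: the term in [A] gives
   the area of a half-disk of radius [c]. The terms in [C] have a multiple of
   [s y ^ 3 / y ^ 2] as primitive, which vanishes at both ends. *)
Lemma integral_disk_slices {R : realType} (b h c A C : R) :
  0 < b -> 0 < h -> 0 < c -> h ^+ 2 = b ^+ 2 * (1 + c ^+ 2) ->
  let s y := Num.sqrt ((b * c) ^+ 2 - (y - h) ^+ 2) in
  (\int[lebesgue_measure]_(y in `[(h - b * c)%R, (h + b * c)%R])
     ((2 * s y * A + 2 / 3 * s y ^+ 3 * C + 2 * s y * (y ^+ 2 - b ^+ 2) * C) /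
      y ^+ 3)%:E)%E
  = (A * pi * c ^+ 2 / b)%:E.
Proof.
move=> b0 h0 c0 hh s.
have bc0 : 0 < b * c by rewrite mulr_gt0.
have hbc : b * c < h.
  (* [h ^+ 2] exceeds [(b * c) ^+ 2] by [b ^+ 2], so the interval of integration stays in
     [y > 0]. *)
  rewrite -ltr_sqr ?nnegrE ?ltW // hh exprMn mulrDr mulr1.
  by rewrite ltr_pwDl // exprn_gt0.
pose v y := b / y - h / b.
pose w y := s y / y.
pose G y := v y * w y + 2 * c ^+ 2 * atan (v y / (c + w y)).
(* The minus sign before [G] compensates [dv = - b / y ^ 2 dy]. *)
pose F y := - (A / b) * G y - 4 / 3 * C * (s y ^+ 3 / y ^+ 2).
have cid (y : R) : {for y, continuous (fun y : R => y)} by exact: cvg_id.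
have cc (k : R) y : {for y, continuous (fun _ : R => k)} by exact: cvg_cst.
have cX (f : R -> R) n y : {for y, continuous f} ->
    {for y, continuous (fun y => f y ^+ n)}.
  move=> cf; apply: (@continuous_comp _ _ _ f (fun x => x ^+ n)) => //.
  exact: exprn_continuous.
have cs y : {for y, continuous s}.
  apply: (@continuous_comp _ _ _ (fun y => (b * c) ^+ 2 - (y - h) ^+ 2)
    Num.sqrt).
    by apply: continuousB => //; apply: cX; apply: continuousB.
  exact: sqrt_continuous.
have cV (f : R -> R) y : f y != 0 -> {for y, continuous f} ->
    {for y, continuous (fun y => (f y)^-1)} by exact: continuousV.
have s0 y : 0 <= s y by exact: sqrtr_ge0.
have y0 y : h - b * c <= y <= h + b * c -> 0 < y by lra.
have -> : A * pi * c ^+ 2 / b = F (h + b * c) - F (h - b * c).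
  have hp : h + b * c != 0 by rewrite gt_eqF //; lra.
  have hm : h - b * c != 0 by rewrite gt_eqF //; lra.
  have sp : s (h + b * c) = 0.
    by rewrite /s addrAC subrr add0r subrr sqrtr0.
  have sm : s (h - b * c) = 0.
    by rewrite /s addrAC subrr add0r sqrrN subrr sqrtr0.
  have b0' : b != 0 by rewrite gt_eqF.
  (* At the ends [w = 0] and [v] is [- c] or [c], so the arctangents are [- pi / 4] and [pi / 4],
     which produces the factor [pi]. *)
  have vp : v (h + b * c) = - c.
    rewrite /v.
    transitivity ((b ^+ 2 - h ^+ 2 - h * b * c) / (b * (h + b * c))).
      by field; rewrite hp.
    by rewrite hh; field; rewrite hp.
  have vm : v (h - b * c) = c.
    rewrite /v.
    transitivity ((b ^+ 2 - h ^+ 2 + h * b * c) / (b * (h - b * c))).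
      by field; rewrite hm.
    by rewrite hh; field; rewrite hm.
  rewrite /F /G /w sp sm vp vm !mul0r !addr0 [- c / c]mulNr divff ?gt_eqF //.
  rewrite atanN atan1.
  by field; rewrite b0' hp hm.
apply: integral_is_derive.
- by lra.
- move=> y /y0 yp; apply: continuousM; last first.
    by apply: cV; [rewrite expf_neq0 // gt_eqF|exact: cX].
  apply: continuousD; first apply: continuousD.
  + by apply: continuousM => //; apply: continuousM.
  + by apply: continuousM => //; apply: continuousM => //; exact: cX.
  + apply: continuousM => //; apply: continuousM => //.
      by apply: continuousM.
    by apply: continuousB => //; exact: cX.
- move=> y /y0 yp.
  have cv : {for y, continuous v}.
    apply: continuousB => //; apply: continuousM => //.
    by apply: cV => //; rewrite gt_eqF.
  have cw : {for y, continuous w}.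
    by apply: continuousM => //; apply: cV => //; rewrite gt_eqF.
  apply: continuousB.
    apply: continuousM => //; apply: continuousD; first exact: continuousM.
    apply: continuousM => //.
    apply: (@continuous_comp _ _ _ (fun y => v y / (c + w y)) atan); last first.
      exact: continuous_atan.
    apply: continuousM => //; apply: cV.
      by rewrite gt_eqF // ltr_wpDr // divr_ge0 // ltW.
    by apply: continuousD.
  apply: continuousM => //; apply: continuousM; first exact: cX.
  by apply: cV; [rewrite expf_neq0 // gt_eqF|exact: cX].
- move=> y hy; have yp : 0 < y by apply: y0; lra.
  have yn : y != 0 by rewrite gt_eqF.
  have bn : b != 0 by rewrite gt_eqF.
  have q0 : 0 < (b * c) ^+ 2 - (y - h) ^+ 2.
    by rewrite subr_sqr mulr_gt0 //; lra.
  have sp : 0 < s y by rewrite sqrtr_gt0.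
  have sn : s y != 0 by rewrite gt_eqF.
  have s2 : s y ^+ 2 = (b * c) ^+ 2 - (y - h) ^+ 2 by rewrite sqr_sqrtr // ltW.
  (* The equation of the bounding circle, using [h ^+ 2 - (b * c) ^+ 2 = b ^+ 2]; substituting it
     for [b ^+ 2] closes the algebraic identities below. *)
  have b2 : b ^+ 2 = 2 * h * y - y ^+ 2 - s y ^+ 2.
    by rewrite s2 exprMn; move: hh; rewrite mulrDr mulr1; lra.
  have dq : is_derive y 1 (fun y => (b * c) ^+ 2 - (y - h) ^+ 2) (2 * (h - y)).
    by apply: is_derive_eq; rewrite /GRing.scale /=; ring.
  have ds : is_derive y 1 s ((h - y) / s y).
    have H := @is_derive1_comp _ _ (fun y => (b * c) ^+ 2 - (y - h) ^+ 2) _ _ _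
      (is_derive1_sqrt q0) dq.
    by apply: (is_derive_eq H); rewrite -/(s y); field.
  have dV : is_derive y 1 (fun y : R => y^-1) (- y ^- 2).
    apply: is_derive_eq; first by apply: is_deriveV.
    by rewrite /GRing.scale /= mulr1.
  have dv : is_derive y 1 v (- b / y ^+ 2).
    by apply: is_derive_eq; rewrite /GRing.scale /=; field.
  have dw : is_derive y 1 w (((h - y) / s y * y - s y) / y ^+ 2).
    by apply: is_derive_eq; rewrite /GRing.scale /=; field; rewrite ?yn ?bn ?sn.
  have vw : v y ^+ 2 + w y ^+ 2 = c ^+ 2.
    transitivity ((b ^+ 2 * (b ^+ 2 - 2 * h * y + s y ^+ 2) + h ^+ 2 * y ^+ 2)
                  / (b ^+ 2 * y ^+ 2)).
      by rewrite /v /w; field; rewrite ?yn ?bn ?sn.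
    rewrite hh {2}b2.
    rewrite (_ : 2 * h * y - _ - _ - _ + _ = - y ^+ 2); last by ring.
    by field; rewrite ?yn ?bn ?sn.
  have VW : v y * (- b / y ^+ 2) + w y * (((h - y) / s y * y - s y) / y ^+ 2)
      = 0.
    transitivity ((2 * h * y - y ^+ 2 - s y ^+ 2 - b ^+ 2) / y ^+ 3).
      by rewrite /v /w; field; rewrite ?yn ?bn ?sn.
    by rewrite b2 subrr mul0r.
  have wp : 0 < w y by rewrite divr_gt0.
  have dG : is_derive y 1 G (2 * w y * (- b / y ^+ 2)).
    exact: is_derive_circle_segment vw VW dv dw.
  have dK : is_derive y 1 (fun y => s y ^+ 3 / y ^+ 2)
      (3 * s y * (h - y) / y ^+ 2 - 2 * s y ^+ 3 / y ^+ 3).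
    have dV2 : is_derive y 1 (fun y : R => y ^- 2) (- 2 / y ^+ 3).
      have y2 : y ^+ 2 != 0 by rewrite expf_neq0.
      have dX : is_derive y 1 (fun y : R => y ^+ 2) (2 * y).
        by apply: is_derive_eq; rewrite /GRing.scale /=; ring.
      apply: (is_derive_eq (@is_deriveV _ (fun y => y ^+ 2) _ _ _ y2 dX)).
      by rewrite /GRing.scale /=; field.
    by apply: is_derive_eq; rewrite /GRing.scale /=; field; rewrite ?yn ?bn ?sn.
  apply: is_derive_eq; rewrite /GRing.scale /= /w.
  transitivity (2 * s y * A / y ^+ 3
     - 4 / 3 * C * (3 * s y * (h - y) / y ^+ 2 - 2 * s y ^+ 3 / y ^+ 3)).
    by field; rewrite ?yn ?bn ?sn.
  by rewrite b2; field.
Qed.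

(** * Integration of linear forms over the disk *)

Lemma hdisk_gt0 {R : realType} (P : R * R) (r : R) X : hdisk P r X -> 0 < X.2.
Proof. by case. Qed.

Lemma lebesgue_hdisk_lty {R : realType} (P : R * R) (r : R) :
  hplane P -> 0 < r ->
  ((@lebesgue_measure R \x @lebesgue_measure R) (hdisk P r) < +oo)%E.
Proof.
move=> hP r0; have [a [b [k [u [v [_ u0 _ _ [_ hu]]]]]]] := hdisk_box hP r0.
pose B : set (measurableTypeR R * measurableTypeR R) :=
  `[a - u, a + u] `*` `[b - u, b + u].
have mB : measurable B by apply: measurableX; exact: measurable_itv.
have mD := hdisk_measurable hP r0.
apply: (@le_lt_trans _ _ ((@lebesgue_measure R \x @lebesgue_measure R)%E B)).
  by apply: le_measure; rewrite ?inE.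
rewrite product_measure1E; [|exact: measurable_itv..].
have lm (c : R) : (@lebesgue_measure R `[(c - u)%R, (c + u)%R]) = (2 * u)%:E.
  rewrite lebesgue_measure_itv /= lte_fin ifT; last by lra.
  by rewrite -EFinB; congr EFin; ring.
apply: (@le_lt_trans _ _ ((2 * u)%:E * (2 * u)%:E)%E).
  by rewrite -{1}(lm a) -(lm b).
by rewrite -EFinM ltry.
Qed.

(** The basis is adapted to [P]: the terms in [B] and [C] vanish at [P], so [A / P.2] is the value
    there, and [A] alone survives integration over the disk. *)
Definition linear_moment {R : realType} (P : R * R) (A B C : R) (X : R * R) :=
  (A + B * (X.1 - P.1) + C * ((X.1 - P.1) ^+ 2 + X.2 ^+ 2 - P.2 ^+ 2)) / X.2.

(** Prepares Fubini: the integrand is continuous on a compact set, hence bounded, and the set has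
    finite measure. *)
Lemma integrable_linear_moment {R : realType} (P : R * R) (r A B C : R) :
  hplane P -> 0 < r ->
  (@lebesgue_measure R \x @lebesgue_measure R)%E.-integrable (hdisk P r)
    (fun X => (linear_moment P A B C X / X.2 ^+ 2)%:E).
Proof.
move=> hP r0.
apply: measurable_bounded_integrable.
- exact: hdisk_measurable.
- exact: lebesgue_hdisk_lty.
(* On the disk [y > 0], so the quotient agrees with a real power that is measurable on the whole
   plane. *)
- apply: (eq_measurable_fun (fun X : measurableTypeR R * measurableTypeR R =>
    (A + B * (X.1 - P.1) + C * ((X.1 - P.1) ^+ 2 + X.2 ^+ 2 - P.2 ^+ 2)) *
    X.2 `^ (- 3))).
    move=> X /[!inE] /hdisk_gt0 X0; rewrite /linear_moment.
    rewrite powRN -[3]/(3%:R) powR_mulrn ?ltW //.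
    by field; rewrite gt_eqF.
  have m1 : measurable_fun [set: measurableTypeR R * measurableTypeR R]
      (fun X => X.1 - P.1) by exact: measurable_funB.
  apply: measurable_funTS; apply: measurable_funM.
    apply: measurable_funD; first apply: measurable_funD => //.
      exact: measurable_funM.
    apply: measurable_funM => //; apply: measurable_funB => //.
    by apply: measurable_funD; exact: measurable_funX.
  exact: (measurableT_comp (@measurable_powR R (- 3)) measurable_snd).
- suff /compact_bounded[M [Mr HM]] :
      compact ((fun X => linear_moment P A B C X / X.2 ^+ 2) @` hdisk P r).
    exists M; split => // x Mx X DX; apply: (HM _ Mx).
    by exists X.
  apply: continuous_compact; last exact: hdisk_compact.
  apply: continuous_in_subspaceT => X; rewrite inE => /hdisk_gt0 X0.
  have c1 : {for X, continuous (fun X : R * R => X.1 - P.1)}.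
    by apply: continuousB; [exact: cvg_fst|exact: cvg_cst].
  have c2 : {for X, continuous (fun X : R * R => X.2)} by exact: cvg_snd.
  have cc (z : R) : {for X, continuous (fun _ : R * R => z)}.
    exact: cvg_cst.
  have cX (f : R * R -> R) : {for X, continuous f} ->
      {for X, continuous (fun X => f X ^+ 2)}.
    move=> cf; apply: (@continuous_comp _ _ _ f (fun x => x ^+ 2)) => //.
    exact: exprn_continuous.
  apply: continuousM; last first.
    apply: continuousV; first by rewrite expf_neq0 // gt_eqF.
    exact: cX.
  apply: continuousM; last by apply: continuousV => //; rewrite gt_eqF.
  apply: continuousD; first apply: continuousD => //.
    exact: continuousM.
  apply: continuousM => //; apply: continuousB => //.
  by apply: continuousD; exact: cX.
Qed.

(** Fubini with [y] as outer variable: the disk is a Euclidean disk of centre [(P.1, h)] and radius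
    [c], and its horizontal slices are intervals centred at [P.1], over which the term in [B] is
    odd. *)
Lemma area_integral_linear_moment {R : realType} (P : R * R) (r A B C : R) :
  hplane P -> 0 < r ->
  area_integral (hdisk P r) (linear_moment P A B C) =
  (A * pi * sinh r ^+ 2 / P.2)%:E.
Proof.
move=> hP r0; have mD := hdisk_measurable hP r0.
have intf := integrable_linear_moment P r A B C hP r0.
rewrite /area_integral integral_mkcond -integral21_prod_meas1; last first.
  exact: (integrable_mkcond _ mD).1 intf.
have b0 : 0 < P.2 by [].
have s0 := sinh_gt0 _ r0.
have h0 : 0 < P.2 * cosh r by rewrite mulr_gt0 ?cosh_gt0.
have hh : (P.2 * cosh r) ^+ 2 = P.2 ^+ 2 * (1 + sinh r ^+ 2).
  by rewrite exprMn cosh_sqr.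
rewrite -(integral_disk_slices _ _ _ A C b0 h0 s0 hh) [RHS]integral_mkcond.
set h := P.2 * cosh r; set c := P.2 * sinh r.
have c0 : 0 < c by rewrite mulr_gt0.
have sqr_le (u t : R) : 0 <= t -> (u ^+ 2 <= t ^+ 2) = (`|u| <= t).
  by move=> t0; rewrite -[u ^+ 2]real_normK ?num_real // ler_sqr ?nnegrE.
apply: eq_integral => y _; rewrite /fubini_G patchE.
have Dy : [set x | hdisk P r (x, y)] =
    [set x | (x - P.1) ^+ 2 <= c ^+ 2 - (y - h) ^+ 2].
  by rewrite hdiskE //; apply/seteqP; split => x /=; rewrite -/h -/c; lra.
rewrite (_ : (fun x => _) = (fun x =>
    (linear_moment P A B C (x, y) / y ^+ 2)%:E) \_ [set x | hdisk P r (x, y)]);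
  last first.
  by apply/funext => x; rewrite !patchE /=; do 2 case: ifPn => //=;
    rewrite ?inE ?notin_setE //.
rewrite -integral_mkcond Dy.
(* For [y] outside [[h - c, h + c]] the slice is empty. *)
case: ifPn; rewrite ?inE ?notin_setE /= in_itv /=; last first.
  move=> yo; rewrite (_ : [set x | _] = set0) ?integral_set0 //.
  rewrite -subset0 => x /= hx; apply: yo.
  have : (y - h) ^+ 2 <= c ^+ 2 by have := sqr_ge0 (x - P.1); lra.
  by rewrite (sqr_le _ _ (ltW c0)) ler_norml; lra.
move=> yi; set s := Num.sqrt _.
have y0 : 0 < y.
  have : c < h.
    rewrite -ltr_sqr ?nnegrE ?ltW // hh exprMn mulrDr mulr1.
    by rewrite ltr_pwDl // exprn_gt0.
  by lra.
have s00 : 0 <= s by exact: sqrtr_ge0.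
have s2 : s ^+ 2 = c ^+ 2 - (y - h) ^+ 2.
  by rewrite sqr_sqrtr // subr_sqr mulr_ge0; lra.
rewrite (_ : [set x | _] = `[P.1 - s, P.1 + s]%classic); last first.
  by apply/seteqP; split => x /=; rewrite -s2 in_itv /= sqr_le // ler_distl.
(* For fixed [y] the integrand is quadratic in [x - P.1]; the part [C * (y ^+ 2 - P.2 ^+ 2)] joins
   the constant term. *)
transitivity (\int[lebesgue_measure]_(x in `[(P.1 - s)%R, (P.1 + s)%R])
  (((A + C * (y ^+ 2 - P.2 ^+ 2)) / y ^+ 3) + B / y ^+ 3 * (x - P.1) +
   C / y ^+ 3 * (x - P.1) ^+ 2)%:E)%E.
  by apply: eq_integral => x _; rewrite /linear_moment /=; congr EFin; field;
    rewrite gt_eqF.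
rewrite integral_quadratic //; congr EFin.
by field; rewrite gt_eqF.
Qed.

(** * Moments, center of mass and mass of the disk *)

(** The normalization that turns [side m X / X.2] into the signed [sinh] of the distance to [m]. *)
Definition side_scale {R : realType} (m : dline R) : R :=
  match m with VLine _ _ => 1 | HCircle _ rho _ => 2 * rho%:num end.

Lemma side_scale_gt0 {R : realType} (m : dline R) : 0 < side_scale m.
Proof. by case: m => //= _ rho _; rewrite mulr_gt0. Qed.

Lemma sigma_sinh_hdist_line {R : realType} (m : dline R) (X : R * R) :
  hplane X ->
  sigma m X * sinh (hdist_line X m) = side m X / (side_scale m * X.2).
Proof.
move=> hX.
suff -> : sinh (hdist_line X m) = `|side m X| / (side_scale m * X.2).
  by rewrite mulrA -numEsg.
case: m => [c up|c rho rw] /=.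
  rewrite sinh_hdist_VLine // normrM mul1r distrC.
  by case: up; rewrite ?normrN normr1 mul1r.
rewrite sinh_hdist_HCircle // normrM.
by case: rw; rewrite ?normrN normr1 mul1r.
Qed.

(** [side m] is affine in [x] and [x ^+ 2 + y ^+ 2]; expanding about [P] leaves its value at [P] as
    constant coefficient. *)
Lemma side_linear_moment {R : realType} (m : dline R) (P : R * R) :
  exists B C : R, forall X, hplane X ->
    side m X / (side_scale m * X.2) =
    linear_moment P (side m P / side_scale m) B C X.
Proof.
rewrite /linear_moment; case: m => [c up|c rho rw] /=.
  exists (- (if up then 1 else -1)), 0 => X X0.
  by case: up; field; rewrite gt_eqF.
exists ((if rw then 1 else -1) / (2 * rho%:num) * 2 * (P.1 - c)).
exists ((if rw then 1 else -1) / (2 * rho%:num)) => X X0.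
by case: rw; field; rewrite !gt_eqF.
Qed.

Lemma eq_area_integral {R : realType} (D : set (R * R)) (f g : R * R -> R) :
  {in D, f =1 g} -> area_integral D f = area_integral D g.
Proof. by move=> fg; apply: eq_integral => X XD; rewrite fg. Qed.

Lemma moment_disk {R : realType} (P : R * R) (r : R) (L : lamina R)
    (m : dline R) :
  hplane P -> 0 < r -> region_set (lregion L) = hdisk P r ->
  has_uniform_density L 1 ->
  moment L m = (side m P / side_scale m * pi * sinh r ^+ 2 / P.2)%:E.
Proof.
move=> hP hr hregion huniform; have [B [C BC]] := side_linear_moment m P.
rewrite /moment hregion -(area_integral_linear_moment P r _ B C) //.
apply: eq_area_integral => X; rewrite inE => DX.
rewrite huniform ?hregion // mulr1 -BC; last by case: DX.
by rewrite sigma_sinh_hdist_line //; case: DX.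
Qed.

Lemma balanced_disk {R : realType} (P : R * R) (r : R) (L : lamina R)
    (m : dline R) :
  hplane P -> 0 < r -> region_set (lregion L) = hdisk P r ->
  has_uniform_density L 1 ->
  balanced L m <-> line_pts m P.
Proof.
move=> hP hr hregion huniform.
(* The moment is [side m P] times this positive factor, so it vanishes exactly when [P] lies on
   [m]. *)
pose K := pi * sinh r ^+ 2 / (side_scale m * P.2).
have K0 : K != 0.
  rewrite gt_eqF // divr_gt0 // mulr_gt0 ?pi_gt0 ?side_scale_gt0 //.
  by apply: exprn_gt0; exact: sinh_gt0.
have mK : side m P / side_scale m * pi * sinh r ^+ 2 / P.2 = side m P * K.
  by rewrite /K; field; rewrite !gt_eqF ?side_scale_gt0.
rewrite /balanced (moment_disk P r) // mK; split => [[]|[_ ->]];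
  last by rewrite mul0r.
by move=> /eqP; rewrite (mulIr_eq0 _ (mulIf K0)) => /eqP.
Qed.

(** Two balancing lines determine the point: the vertical line through [P] and the half-circle about
    [(P.1, 0)] of radius [P.2] meet only at [P]. *)
Lemma center_of_mass_disk {R : realType} (P : R * R) (r : R) (L : lamina R) :
  hplane P -> 0 < r -> region_set (lregion L) = hdisk P r ->
  has_uniform_density L 1 ->
  center_of_mass L = P.
Proof.
move=> hP hr hregion huniform.
have bal m := balanced_disk P r L m hP hr hregion huniform.
apply: xget_unique; first by split=> // m /bal.
case=> p q [q0 pq]; rewrite /hplane /= in q0 hP.
have : line_pts (VLine P.1 true) (p, q).
  by apply/pq/bal; split => //=; rewrite subrr mulr0.
move=> [_ /= hp].
have : line_pts (HCircle P.1 (PosNum hP) true) (p, q).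
  by apply/pq/bal; split => //=; ring.
move=> [_ /= hq].
have pE : p = P.1 by lra.
rewrite pE [RHS]surjective_pairing; congr pair.
apply/eqP; rewrite -(@eqrXn2 _ 2) ?ltW //; apply/eqP.
by move: hq; rewrite pE; lra.
Qed.

Theorem proposition6p2 (R : realType) (P : R * R) (r : R) (L : lamina R)
    (hP : hplane P) (hr : 0 < r)
    (hregion : region_set (lregion L) = hdisk P r)
    (huniform : has_uniform_density L 1) :
  mass L = (pi * sinh r ^+ 2)%:E.
Proof.
rewrite /mass (center_of_mass_disk P r) // hregion.
(* [cosh] of the distance to [P = (a, b)] is [((x - a) ^+ 2 + y ^+ 2 + b ^+ 2) / (2 * b * y)];
   splitting off [b / y] gives the coefficients [b], [0] and [1 / (2 * b)]. *)
rewrite (eq_area_integral _ _ (linear_moment P P.2 0 (2 * P.2)^-1)).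
  by rewrite area_integral_linear_moment //; congr EFin; field; rewrite gt_eqF.
move=> X; rewrite inE => DX; have X0 := hdisk_gt0 _ _ _ DX.
rewrite huniform ?hregion // mul1r cosh_hdist // /linear_moment.
by field; rewrite !gt_eqF.
Qed.
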